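(* For every $s>0$ there exists a separable metric space $X$ with $\operatorname{tHD}(X)=0$ and $\dim_H X\ge s$. (This is proved in ZFC.)
   Context: For a metric space $X$, the transfinite Hausdorff dimension is $\operatorname{tHD}(X)=\sup\{\operatorname{trind} f(Y): Y\subset X,\ f:Y\to Z \text{ Lipschitz},\ Z \text{ a metric space}\}$, where $\operatorname{trind}$ denotes the transfinite small inductive (topological) dimension. $\dim_H$ denotes Hausdorff dimension. *)

(* Defs.v *)
From Stdlib Require Import Reals Lra ClassicalEpsilon.
Open Scope R_scope.

Record MetricSpace := {
  carrier :> Type;
  dist : carrier -> carrier -> R;
  dist_nonneg : forall x y, 0 <= dist x y;
  dist_eq0 : forall x y, dist x y = 0 <-> x = y;
  dist_sym : forall x y, dist x y = dist y x;
  dist_tri : forall x y z, dist x z <= dist x y + dist y z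
}.

Arguments dist {m} _ _.

Definition countable_set {X : Type} (D : X -> Prop) : Prop :=
  exists g : X -> nat, forall x y, D x -> D y -> g x = g y -> x = y.

Definition dense {X : MetricSpace} (D : X -> Prop) : Prop :=
  forall x : X, forall eps, 0 < eps -> exists d, D d /\ dist x d < eps.

Definition separable (X : MetricSpace) : Prop :=
  exists D : X -> Prop, countable_set D /\ dense D.

Definition rel_open {Z : MetricSpace} (A U : Z -> Prop) : Prop :=
  (forall z, U z -> A z) /\
  (forall z, U z -> exists r, 0 < r /\ forall w, A w -> dist z w < r -> U w).

Definition rel_closure {Z : MetricSpace} (A U : Z -> Prop) (z : Z) : Prop :=
  A z /\ forall r, 0 < r -> exists w, U w /\ A w /\ dist z w < r.

Definition rel_interior {Z : MetricSpace} (A U : Z -> Prop) (z : Z) : Prop :=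
  A z /\ exists r, 0 < r /\ forall w, A w -> dist z w < r -> U w.

Definition rel_boundary {Z : MetricSpace} (A U : Z -> Prop) (z : Z) : Prop :=
  rel_closure A U z /\ ~ rel_interior A U z.

Definition ind_le_m1 {Z : Type} (A : Z -> Prop) : Prop := forall z, ~ A z.

Definition ind_le_0 {Z : MetricSpace} (A : Z -> Prop) : Prop :=
  forall z, A z -> forall W, rel_open A W -> W z ->
    exists V, rel_open A V /\ V z /\ (forall w, V w -> W w) /\
              ind_le_m1 (rel_boundary A V).

Definition trind_eq_0 {Z : MetricSpace} (A : Z -> Prop) : Prop :=
  ind_le_0 A /\ ~ ind_le_m1 A.

Definition lipschitz_on {X Z : MetricSpace} (Y : X -> Prop)
    (f : {x : X | Y x} -> Z) : Prop :=
  exists L, 0 <= L /\ forall a b : {x : X | Y x},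
    dist (f a) (f b) <= L * dist (proj1_sig a) (proj1_sig b).

Definition image_of {X Z : MetricSpace} (Y : X -> Prop)
    (f : {x : X | Y x} -> Z) : Z -> Prop :=
  fun z => exists a, f a = z.

(** * Transfinite Hausdorff dimension equal to 0:
    tHD(X) = sup { trind f(Y) } = 0, i.e. every Lipschitz image of a subset
    has trind defined and <= 0, and the value 0 is attained. *)
Definition tHD_eq_0 (X : MetricSpace) : Prop :=
  (forall (Y : X -> Prop) (Z : MetricSpace) (f : {x : X | Y x} -> Z),
      lipschitz_on Y f -> ind_le_0 (image_of Y f)) /\
  (exists (Y : X -> Prop) (Z : MetricSpace) (f : {x : X | Y x} -> Z),
      lipschitz_on Y f /\ trind_eq_0 (image_of Y f)).

Definition bounded_set {X : MetricSpace} (U : X -> Prop) : Prop :=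
  exists M, forall x y, U x -> U y -> dist x y <= M.

Definition dist_set {X : MetricSpace} (U : X -> Prop) (r : R) : Prop :=
  exists x y, U x /\ U y /\ r = dist x y.

Lemma dist_set_bound {X : MetricSpace} (U : X -> Prop) :
  (exists x, U x) /\ bounded_set U -> bound (dist_set U).
Proof.
  intros [_ [M HM]]. exists M. intros r [x [y [Hx [Hy ->]]]]. now apply HM.
Qed.

Lemma dist_set_ne {X : MetricSpace} (U : X -> Prop) :
  (exists x, U x) /\ bounded_set U -> exists r, dist_set U r.
Proof.
  intros [[x Hx] _]. exists (dist x x). now exists x, x.
Qed.

(** diameter (sup of distances) of a nonempty bounded set; 0 otherwise
    (only used for sets of diameter <= delta, which are bounded). *)
Definition diam {X : MetricSpace} (U : X -> Prop) : R :=
  match excluded_middle_informative ((exists x, U x) /\ bounded_set U) with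
  | left H => proj1_sig (completeness (dist_set U) (dist_set_bound U H)
                                      (dist_set_ne U H))
  | right _ => 0
  end.

(** diam(U)^t with the usual conventions: diam(empty)^t = 0, 0^0 = 1. *)
Definition hpow {X : MetricSpace} (U : X -> Prop) (t : R) : R :=
  match excluded_middle_informative (exists x, U x) with
  | left _ =>
      if Req_EM_T (diam U) 0 then (if Req_EM_T t 0 then 1 else 0)
      else Rpower (diam U) t
  | right _ => 0
  end.

(** H^t(X) = sup_{delta>0} inf { sum_n diam(U_n)^t : (U_n) countable cover of X,
    diam U_n <= delta }.  H^t(X) = 0 unfolds to: for every delta > 0 and
    eps > 0 there is a countable delta-cover with sum <= eps. *)
Definition hausdorff_measure_zero (X : MetricSpace) (t : R) : Prop :=
  forall delta, 0 < delta -> forall eps, 0 < eps ->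
    exists U : nat -> (X -> Prop),
      (forall x : X, exists n, U n x) /\
      (forall n, diam (U n) <= delta /\ bounded_set (U n)) /\
      (forall N, sum_f_R0 (fun n => hpow (U n) t) N <= eps).

(** dim_H X = inf { t >= 0 : H^t(X) = 0 } (= +infinity if this set is empty);
    dim_H X >= s  iff  every t >= 0 with H^t(X) = 0 satisfies t >= s. *)
Definition dimH_ge (X : MetricSpace) (s : R) : Prop :=
  forall t, 0 <= t -> hausdorff_measure_zero X t -> s <= t.

(* Main.v *)
(* A Lipschitz image is zero-dimensional as soon as the distances to a point omit
   arbitrarily small values, so it suffices to find a separable X of dimension at
   least s such that no real-valued Lipschitz function on a subset of X takes every
   value in [0,1]. Fix a natural number p >= s and call a set small if it has fewer
   than continuum many points.

   If some small subset of the Baire space, with distance 2^-n between sequences first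
   differing at n, has no cover by cylinders with a small sum of p-th powers of
   diameters, it is the required X: it is too small to be mapped onto [0,1].

   Otherwise, X is built by transfinite recursion inside a compact ultrametric tree
   with (n!)^p nodes of diameter 1/n! at level n. Stage a picks a point x_a outside
   the a-th cover of small mass, and a value r_a not taken by the a-th Lipschitz
   function g_a at x_b, b <= a; later points must avoid the level set g_a = r_a.
   The value is taken in a Cantor scheme all of whose values have the property that
   the nodes of level n on which g_a is close to r_a have relative number
   O(2^-pn). This sequence of finite sets of nodes is a point of the Baire space;
   by assumption the fewer than continuum many points arising before a stage have
   a cover by cylinders with small sum, and the last coordinates of these cylinders
   are countably many sets of nodes of small total mass. A point outside all of them
   avoids every earlier level set. *)

From mathcomp Require boolp wochoice.
From Stdlib Require Import Reals Lra Lia Arith Cantor Classical ClassicalEpsilon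
  ProofIrrelevance FunctionalExtensionality.
Require Import Defs.
Open Scope R_scope.
Set Bullet Behavior "Strict Subproofs".


(** * Well-ordering the continuum *)

(** Every nonempty set has a unique least element for [R]; singletons give reflexivity, pairs
    antisymmetry and totality, and [lt] is the strict part. *)
Lemma well_order_exists (T : Type) :
  exists lt : T -> T -> Prop, well_founded lt /\
    forall a b, lt a b \/ a = b \/ lt b a.
Proof.
  destruct (wochoice.well_ordering_principle (boolp.boolp_classicType__canonical__eqtype_Equality T)) as [R HR].
  assert (least : forall P : T -> Prop, (exists x, P x) ->
            exists z, P z /\ (forall x, P x -> R z x = true) /\
              forall y, P y -> (forall x, P x -> R y x = true) -> z = y).
  { intros P [x0 Hx0].
    set (A := fun x : T => if excluded_middle_informative (P x) then true else false).
    assert (HA : forall x, A x = true <-> P x).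
    { intro x. unfold A. destruct (excluded_middle_informative (P x)); intuition discriminate. }
    destruct (HR A) as [z [[Hz Hmin] Huniq]].
    { exists x0. apply HA, Hx0. }
    exists z. split; [now apply HA |]. split.
    - intros x Hx. apply Hmin. apply HA, Hx.
    - intros y Hy Hmy. apply Huniq. split; [apply HA, Hy|].
      intros x Hx. apply Hmy. apply HA, Hx. }
  assert (refl : forall x, R x x = true).
  { intro x. destruct (least (fun y => y = x)) as [z [-> [H _]]]; eauto. }
  assert (anti : forall x y, R x y = true -> R y x = true -> x = y).
  { intros x y Hxy Hyx.
    destruct (least (fun z => z = x \/ z = y)) as [z [_ [_ H]]]; [eauto|].
    rewrite <- (H x), <- (H y); intuition (subst; auto). }
  exists (fun x y => R x y = true /\ x <> y). split.
  - intro a. apply NNPP. intro Ha.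
    destruct (least (fun x => ~ Acc (fun x y => R x y = true /\ x <> y) x))
      as [z [Hz [Hmin _]]]; [eauto|].
    apply Hz. constructor. intros y [Hyz Hne]. apply NNPP. intro Hy.
    apply Hne, anti; auto.
  - intros a b. destruct (classic (a = b)) as [|Hne]; [auto|].
    destruct (least (fun z => z = a \/ z = b)) as [z [[-> | ->] [H _]]]; [eauto| |].
    + left; auto.
    + right; right; auto.
Qed.

(* Either no initial segment of a well-order of the Cantor set maps onto the
   Cantor set, or the least such segment is the index set sought. *)
Lemma continuum_well_order :
  exists (I : Type) (lt : I -> I -> Prop) (enum : I -> nat -> bool),
    well_founded lt /\ (forall a b, lt a b \/ a = b \/ lt b a) /\
    (forall e, exists a, enum a = e) /\
    (forall a (f : I -> nat -> bool), exists e, forall b, lt b a -> f b <> e).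
Proof.
  set (T := nat -> bool).
  destruct (well_order_exists T) as [lt [wf tri]].
  set (onto := fun a => exists f : T -> T, forall e, exists b, lt b a /\ f b = e).
  assert (H : exists (P : T -> Prop) (f : T -> T),
             (forall e, exists b, P b /\ f b = e) /\ (forall a, P a -> ~ onto a)).
  { destruct (classic (exists a, onto a)) as [Hex | Hno].
    - destruct Hex as [a0 Ha0]. revert Ha0.
      induction (wf a0) as [a _ IH]. intro Ha.
      destruct (classic (exists b, lt b a /\ onto b)) as [[b [Hb Hob]] | Hn].
      + exact (IH b Hb Hob).
      + destruct Ha as [f Hf]. exists (fun b => lt b a), f. split; [exact Hf|].
        intros b Hb Hob. apply Hn. eauto.
    - exists (fun _ => True), (fun e => e). split; [eauto|].
      intros a _ Ha. apply Hno. eauto. }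
  destruct H as [P [f [Hf HP]]].
  exists {x : T | P x}, (fun a b => lt (proj1_sig a) (proj1_sig b)),
    (fun a => f (proj1_sig a)). refine (conj _ (conj _ (conj _ _))).
  - intros [a Ha]. induction (wf a) as [a _ IH]. constructor.
    intros [b Hb] Hlt. apply IH, Hlt.
  - intros [a Ha] [b Hb]. cbn. destruct (tri a b) as [| [-> |]]; auto.
    right; left. f_equal. apply proof_irrelevance.
  - intro e. destruct (Hf e) as [b [Hb Hfb]]. now exists (exist _ b Hb).
  - intros [a Ha] g. apply NNPP. intro Hn. apply (HP a Ha).
    (* A surjection from the part of [P] below [a], extended arbitrarily, would be one from the
       whole segment below [a]. *)
    exists (fun b => match excluded_middle_informative (P b) with
                     | left H => g (exist _ b H) | right _ => b end).
    intro e. apply NNPP. intro He. apply Hn. exists e.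
    intros [b Hb] Hlt Hg. cbn in Hlt. apply He. exists b. split; [exact Hlt|].
    destruct (excluded_middle_informative (P b)) as [H|]; [|tauto].
    now rewrite (proof_irrelevance _ H Hb).
Qed.

(** [P a f d] depends on [f] only below [a], so values not yet constructed may be filled with the
    default [d0]. *)
Lemma wf_choice_recursion (I D : Type) (d0 : D) (lt : I -> I -> Prop)
    (P : I -> (I -> D) -> D -> Prop) :
  well_founded lt ->
  (forall a f g d, (forall b, lt b a -> f b = g b) -> P a f d -> P a g d) ->
  (forall a f, exists d, P a f d) ->
  exists f : I -> D, forall a, P a f (f a).
Proof.
  intros wf ext ex.
  set (total := fun a (rec : forall b, lt b a -> D) b =>
    match excluded_middle_informative (lt b a) with
    | left H => rec b H | right _ => d0 end).
  set (step := fun a rec =>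
    proj1_sig (constructive_indefinite_description _ (ex a (total a rec)))).
  exists (Fix wf (fun _ => D) step). intro a.
  rewrite Fix_eq.
  - unfold step at 2.
    destruct (constructive_indefinite_description _ _) as [d Hd]. cbn.
    revert Hd. apply ext. intros b Hb. unfold total.
    now destruct (excluded_middle_informative (lt b a)).
  - intros x f g Hfg. f_equal.
    apply functional_extensionality_dep. intro b.
    apply functional_extensionality_dep. intro Hb. apply Hfg.
Qed.
(** * Counting in the factorial tree *)

Definition dec (P : Prop) : nat := if excluded_middle_informative P then 1 else 0.

Fixpoint cnt (P : nat -> Prop) (n : nat) : nat :=
  match n with O => 0 | S k => cnt P k + dec (P k) end.

Fixpoint nsum (f : nat -> nat) (n : nat) : nat :=
  match n with O => 0 | S k => nsum f k + f k end.

Lemma dec_true (P : Prop) : P -> dec P = 1%nat.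
Proof. unfold dec. now destruct (excluded_middle_informative P). Qed.

Lemma dec_false (P : Prop) : ~ P -> dec P = 0%nat.
Proof. unfold dec. now destruct (excluded_middle_informative P). Qed.

Lemma dec_le (P Q : Prop) : (P -> Q) -> (dec P <= dec Q)%nat.
Proof.
  unfold dec. destruct (excluded_middle_informative P),
    (excluded_middle_informative Q); intro; try lia. tauto.
Qed.

Lemma cnt_le (P Q : nat -> Prop) n :
  (forall i, (i < n)%nat -> P i -> Q i) -> (cnt P n <= cnt Q n)%nat.
Proof.
  induction n as [|n IH]; cbn; intro H; [lia|].
  specialize (IH (fun i Hi => H i (Nat.lt_lt_succ_r _ _ Hi))).
  pose proof (dec_le (P n) (Q n) (H n (Nat.lt_succ_diag_r n))). lia.
Qed.

Lemma cnt_ext (P Q : nat -> Prop) n :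
  (forall i, (i < n)%nat -> P i <-> Q i) -> cnt P n = cnt Q n.
Proof.
  intro H. apply Nat.le_antisymm; apply cnt_le; intros i Hi; apply H, Hi.
Qed.

Lemma cnt_bound (P : nat -> Prop) n : (cnt P n <= n)%nat.
Proof.
  induction n as [|n IH]; cbn; [lia|].
  pose proof (dec_le (P n) True (fun _ => Logic.I)).
  rewrite (dec_true True Logic.I) in H. lia.
Qed.

Lemma cnt_or (P Q : nat -> Prop) n :
  (cnt (fun i => P i \/ Q i) n <= cnt P n + cnt Q n)%nat.
Proof.
  induction n as [|n IH]; cbn; [lia|].
  assert (dec (P n \/ Q n) <= dec (P n) + dec (Q n))%nat; [|lia].
  unfold dec. destruct (excluded_middle_informative (P n)),
    (excluded_middle_informative (Q n)),
    (excluded_middle_informative (P n \/ Q n)); try lia; tauto.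
Qed.

Lemma cnt_not (P : nat -> Prop) n : (cnt P n + cnt (fun i => ~ P i) n = n)%nat.
Proof.
  induction n as [|n IH]; cbn; [lia|].
  destruct (classic (P n)) as [H|H].
  - rewrite (dec_true _ H), (dec_false (~ P n)) by tauto. lia.
  - rewrite (dec_false _ H), (dec_true (~ P n)) by tauto. lia.
Qed.

Lemma cnt_all (P : nat -> Prop) n :
  (forall i, (i < n)%nat -> P i) -> cnt P n = n.
Proof.
  intro H. induction n as [|n IH]; cbn; [lia|].
  rewrite IH, dec_true by auto with arith. lia.
Qed.

Lemma cnt_none (P : nat -> Prop) n :
  (forall i, (i < n)%nat -> ~ P i) -> cnt P n = 0%nat.
Proof.
  intro H. induction n as [|n IH]; cbn; [lia|].
  rewrite IH, dec_false by auto with arith. lia.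
Qed.

Lemma cnt_lt_ex (P : nat -> Prop) n :
  (cnt P n < n)%nat -> exists i, (i < n)%nat /\ ~ P i.
Proof.
  intro H. apply NNPP. intro Hn. rewrite cnt_all in H; [lia|].
  intros i Hi. apply NNPP. intro HP. apply Hn. eauto.
Qed.

Lemma cnt_above (P : nat -> Prop) a n :
  (forall i, (i < n)%nat -> P i -> (a <= i)%nat) -> (cnt P n <= n - a)%nat.
Proof.
  induction n as [|n IH]; cbn [cnt]; intro H; [lia|].
  specialize (IH (fun i Hi => H i (Nat.lt_lt_succ_r _ _ Hi))).
  destruct (classic (P n)) as [HP|HP].
  - rewrite dec_true by assumption. specialize (H n (Nat.lt_succ_diag_r n) HP). lia.
  - rewrite dec_false by assumption. lia.
Qed.

Lemma cnt_spread (P : nat -> Prop) W n :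
  (forall i j, (i < n)%nat -> (j < n)%nat -> P i -> P j -> (i <= j + W)%nat) ->
  (cnt P n <= W + 1)%nat.
Proof.
  induction n as [|n IH]; intro H; [cbn; lia|].
  destruct (classic (P n)) as [HP|HP].
  - pose proof (cnt_above P (n - W) (S n)).
    assert (cnt P (S n) <= S n - (n - W))%nat; [|lia].
    apply H0. intros i Hi HPi. specialize (H n i (Nat.lt_succ_diag_r n) Hi HP HPi). lia.
  - cbn. rewrite dec_false by assumption.
    assert (cnt P n <= W + 1)%nat; [|lia]. apply IH. intros i j Hi Hj. apply H; lia.
Qed.

Lemma cnt_add (P : nat -> Prop) a b :
  cnt P (a + b) = (cnt P a + cnt (fun i => P (a + i)%nat) b)%nat.
Proof.
  induction b as [|b IH]; [rewrite Nat.add_0_r; cbn; lia|].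
  rewrite Nat.add_succ_r. cbn. lia.
Qed.

Lemma cnt_div (P : nat -> Prop) b n :
  (0 < b)%nat -> cnt (fun i => P (i / b)%nat) (n * b) = (b * cnt P n)%nat.
Proof.
  intro Hb. induction n as [|n IH]; [cbn; lia|].
  replace (S n * b)%nat with (n * b + b)%nat by lia. rewrite cnt_add, IH. cbn [cnt].
  enough (cnt (fun i => P ((n * b + i) / b)%nat) b = b * dec (P n))%nat by lia.
  rewrite (cnt_ext _ (fun _ => P n)).
  - destruct (classic (P n)) as [H|H].
    + rewrite cnt_all, dec_true by auto. lia.
    + rewrite cnt_none, dec_false by auto. lia.
  - intros i Hi. rewrite Nat.div_add_l by lia. rewrite Nat.div_small by lia.
    now rewrite Nat.add_0_r.
Qed.

Lemma nsum_plus f g n : nsum (fun i => f i + g i)%nat n = (nsum f n + nsum g n)%nat.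
Proof. induction n as [|n IH]; cbn; lia. Qed.

Lemma nsum_dec (P : nat -> Prop) n : nsum (fun i => dec (P i)) n = cnt P n.
Proof. induction n as [|n IH]; cbn; lia. Qed.

(** Double counting: the pairs related by [R] are summed over [v] instead of over [j]. *)
Lemma nsum_cnt_le (R : nat -> nat -> Prop) (A : nat -> Prop) W B n :
  (forall v, (v < n)%nat -> (cnt (fun j => R j v) B <= W * dec (A v))%nat) ->
  (nsum (fun j => cnt (R j) n) B <= W * cnt A n)%nat.
Proof.
  induction n as [|n IH]; intro H.
  - cbn. rewrite Nat.mul_0_r. clear H. induction B; cbn; lia.
  - cbn. rewrite nsum_plus, nsum_dec.
    specialize (IH (fun i Hi => H i (Nat.lt_lt_succ_r _ _ Hi))).
    specialize (H n (Nat.lt_succ_diag_r n)). lia.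
Qed.

Lemma cnt_markov (P : nat -> Prop) f c k n :
  (forall j, (j < n)%nat -> P j -> (c <= k * f j)%nat) ->
  (cnt P n * c <= k * nsum f n)%nat.
Proof.
  induction n as [|n IH]; cbn; intro H; [lia|].
  specialize (IH (fun i Hi => H i (Nat.lt_lt_succ_r _ _ Hi))).
  specialize (H n (Nat.lt_succ_diag_r n)).
  destruct (classic (P n)) as [HP|HP].
  - rewrite dec_true by assumption. specialize (H HP). lia.
  - rewrite dec_false by assumption. lia.
Qed.

(** With this exponent, the [p]-th power of the diameter 1/n! of a node of level [n] is its share
    among the nodes of that level. *)
Definition width (p n : nat) : nat := (fact n ^ p)%nat.

Definition branching (p n : nat) : nat := (S n ^ p)%nat.

Lemma width_pos p n : (0 < width p n)%nat.
Proof. apply Nat.neq_0_lt_0, Nat.pow_nonzero, fact_neq_0. Qed.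

Lemma branching_pos p n : (0 < branching p n)%nat.
Proof. apply Nat.neq_0_lt_0, Nat.pow_nonzero. lia. Qed.

Lemma width_0 p : width p 0 = 1%nat.
Proof. apply Nat.pow_1_l. Qed.

Lemma width_S p n : width p (S n) = (width p n * branching p n)%nat.
Proof.
  unfold width, branching. rewrite <- Nat.pow_mul_l. f_equal.
  rewrite fact_simpl. lia.
Qed.

Lemma width_divides p l j : exists D, (0 < D)%nat /\ width p (l + j) = (width p l * D)%nat.
Proof.
  induction j as [|j [D [HD IH]]].
  - exists 1%nat. rewrite Nat.add_0_r. lia.
  - exists (D * branching p (l + j))%nat. pose proof (branching_pos p (l + j)).
    rewrite Nat.add_succ_r, width_S, IH. nia.
Qed.

(* A point is recorded by the numbers of its ancestors: the [width p n] nodes of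
   level [n] are [0 .. width p n - 1] and the parent of [v] is [v / branching p n]. *)
Definition branch (p : nat) (x : nat -> nat) : Prop :=
  x O = O /\ forall n, (x (S n) / branching p n)%nat = x n.

Lemma branch_lt p x n : branch p x -> (x n < width p n)%nat.
Proof.
  intros [H0 HS]. induction n as [|n IH].
  - rewrite H0, width_0. lia.
  - rewrite width_S. rewrite <- (HS n) in IH.
    pose proof (branching_pos p n).
    pose proof (Nat.mul_succ_div_gt (x (S n)) (branching p n)). nia.
Qed.

Lemma branch_agree p x y n i :
  branch p x -> branch p y -> x n = y n -> (i <= n)%nat -> x i = y i.
Proof.
  intros Hx Hy. induction n as [|n IH]; intros E Hi.
  - now replace i with O by lia.
  - destruct (Nat.eq_dec i (S n)) as [-> |]; [exact E|].
    apply IH; [|lia]. now rewrite <- (proj2 Hx n), <- (proj2 Hy n), E.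
Qed.

(** Up to level [m] the formula gives the ancestors of [w], because widths divide one another;
    beyond [m] it gives the least-numbered descendant. *)
Lemma branch_through p m w : (w < width p m)%nat -> exists x, branch p x /\
  forall n, x n = (w * width p n / width p m)%nat.
Proof.
  intro Hw. exists (fun n => w * width p n / width p m)%nat. split; [|auto].
  pose proof (width_pos p m). split.
  - rewrite width_0. apply Nat.div_small. lia.
  - intro n. pose proof (branching_pos p n).
    rewrite Nat.Div0.div_div, width_S, Nat.mul_assoc.
    apply Nat.Div0.div_mul_cancel_r. lia.
Qed.

(* A natural number codes a level together with a finite set of nodes of that level. *)
Definition clevel (a : nat) : nat := fst (Cantor.of_nat a).
Definition cset (a v : nat) : Prop := Nat.testbit (snd (Cantor.of_nat a)) v = true.
Definition hits (x : nat -> nat) (a : nat) : Prop := cset a (x (clevel a)).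
Definition mass (p a : nat) : R :=
  INR (cnt (cset a) (width p (clevel a))) / INR (width p (clevel a)).

Lemma code_exists (l n : nat) (A : nat -> Prop) :
  exists a, clevel a = l /\ forall v, (v < n)%nat -> cset a v <-> A v.
Proof.
  assert (H : exists b, forall v, (Nat.testbit b v = true <-> ((v < n)%nat /\ A v))).
  { induction n as [|n [b Hb]].
    - exists O. intro v. rewrite Nat.bits_0. intuition (discriminate || lia).
    - destruct (classic (A n)) as [HA|HA].
      + exists (Nat.setbit b n). intro v.
        rewrite Nat.setbit_eqb, Bool.orb_true_iff, Nat.eqb_eq, Hb.
        split; [intros [<- | [? ?]]; split; auto; lia|].
        intros [Hv HAv]. destruct (Nat.eq_dec n v); [auto | right; split; [lia|auto]].
      + exists b. intro v. rewrite Hb.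
        split; [intros [? ?]; split; auto; lia|].
        intros [Hv HAv]. split; auto.
        destruct (Nat.eq_dec n v); [subst; tauto | lia]. }
  destruct H as [b Hb]. exists (Cantor.to_nat (l, b)).
  unfold clevel, cset. rewrite Cantor.cancel_of_to. cbn. split; [reflexivity|].
  intros v Hv. rewrite Hb. tauto.
Qed.

Lemma INR_width_pos p n : 0 < INR (width p n).
Proof. apply lt_0_INR, width_pos. Qed.

(** All nodes of level [clevel a] have equally many descendants at level [m], so lifting preserves
    proportions. *)
Lemma mass_lift p a m : (clevel a <= m)%nat ->
  INR (cnt (fun w => cset a (w * width p (clevel a) / width p m)%nat) (width p m))
    = INR (width p m) * mass p a.
Proof.
  intro Hm. destruct (width_divides p (clevel a) (m - clevel a)) as [D [HD E]].
  replace (clevel a + (m - clevel a))%nat with m in E by lia.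
  pose proof (width_pos p (clevel a)). unfold mass.
  rewrite (cnt_ext _ (fun w => cset a (w / D)%nat)).
  - rewrite E. rewrite cnt_div by assumption. rewrite !mult_INR.
    field. apply not_0_INR. lia.
  - intros w _. rewrite E, (Nat.mul_comm (width p (clevel a))).
    rewrite Nat.Div0.div_mul_cancel_r by lia. tauto.
Qed.

(** Union bound at a level [m] beyond the levels of all these sets: a total proportion below 1
    leaves a free node. *)
Lemma finite_avoid p h1 h2 K :
  sum_f_R0 (fun k => mass p (h1 k)) K + sum_f_R0 (fun k => mass p (h2 k)) K < 1 ->
  exists x, branch p x /\ forall k, (k <= K)%nat -> ~ hits x (h1 k) /\ ~ hits x (h2 k).
Proof.
  intro Hsum.
  assert (Hm : exists m, forall k, (k <= K)%nat ->
    (clevel (h1 k) <= m)%nat /\ (clevel (h2 k) <= m)%nat).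
  { clear. induction K as [|K [m IH]].
    - exists (clevel (h1 O) + clevel (h2 O))%nat. intros k Hk.
      replace k with O by lia. lia.
    - exists (m + clevel (h1 (S K)) + clevel (h2 (S K)))%nat. intros k Hk.
      destruct (Nat.eq_dec k (S K)) as [-> |]; [lia|].
      specialize (IH k ltac:(lia)). lia. }
  destruct Hm as [m Hm].
  set (bad := fun (h : nat -> nat) k w => cset (h k) (w * width p (clevel (h k)) / width p m)%nat).
  set (any := fun J w => exists k, (k <= J)%nat /\ (bad h1 k w \/ bad h2 k w)).
  assert (Hone : forall k, (k <= K)%nat ->
    INR (cnt (fun w => bad h1 k w \/ bad h2 k w) (width p m)) <=
    INR (width p m) * (mass p (h1 k) + mass p (h2 k))).
  { intros k Hk. destruct (Hm k Hk) as [Hk1 Hk2].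
    rewrite Rmult_plus_distr_l, <- !mass_lift by assumption.
    rewrite <- plus_INR. apply le_INR, cnt_or. }
  assert (Hcnt : forall J, (J <= K)%nat -> INR (cnt (any J) (width p m)) <=
    INR (width p m) * (sum_f_R0 (fun k => mass p (h1 k)) J
                       + sum_f_R0 (fun k => mass p (h2 k)) J)).
  { induction J as [|J IH]; intro HJ.
    - cbn. refine (Rle_trans _ _ _ _ (Hone O HJ)). apply le_INR, cnt_le.
      intros w _ [k [Hk H]]. now replace O with k by lia.
    - cbn. specialize (IH ltac:(lia)). specialize (Hone (S J) HJ).
      assert (INR (cnt (any (S J)) (width p m)) <=
        INR (cnt (any J) (width p m)) +
        INR (cnt (fun w => bad h1 (S J) w \/ bad h2 (S J) w) (width p m))); [|lra].
      rewrite <- plus_INR. apply le_INR.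
      refine (Nat.le_trans _ _ _ _ (cnt_or _ _ _)). apply cnt_le.
      intros w _ [k [Hk H]]. destruct (Nat.eq_dec k (S J)) as [-> |]; [now right|].
      left. exists k. split; [lia | exact H]. }
  destruct (cnt_lt_ex (any K) (width p m)) as [w [Hw Hno]].
  { apply INR_lt. refine (Rle_lt_trans _ _ _ (Hcnt K (Nat.le_refl K)) _).
    pose proof (INR_width_pos p m). nra. }
  destruct (branch_through p m w Hw) as [x [Hx Ex]]. exists x. split; [exact Hx|].
  intros k Hk. unfold hits. rewrite !Ex.
  split; intro H; apply Hno; exists k; unfold bad; auto.
Qed.

Lemma bounded_uniform (Q : nat -> nat -> Prop) b :
  (forall j K K', (K <= K')%nat -> Q j K -> Q j K') ->
  (forall j, (j < b)%nat -> exists K, Q j K) ->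
  exists K, forall j, (j < b)%nat -> Q j K.
Proof.
  intros mono. induction b as [|b IH]; intro H.
  - exists O. lia.
  - destruct IH as [K HK]; [auto with arith|]. destruct (H b) as [K' HK']; [lia|].
    exists (K + K')%nat. intros j Hj. destruct (Nat.eq_dec j b) as [-> |].
    + apply mono with K'; [lia | assumption].
    + apply mono with K; [lia | apply HK; lia].
Qed.

(* Koenig's lemma for the tree of nodes that lie, for every [K], on a branch
   avoiding the first [K] sets. *)
Lemma branch_avoid p h1 h2 c1 c2 : c1 + c2 < 1 ->
  (forall K, sum_f_R0 (fun k => mass p (h1 k)) K <= c1) ->
  (forall K, sum_f_R0 (fun k => mass p (h2 k)) K <= c2) ->
  exists x, branch p x /\ forall k, ~ hits x (h1 k) /\ ~ hits x (h2 k).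
Proof.
  intros Hc H1 H2.
  set (ok := fun K x => branch p x /\
    forall k, (k <= K)%nat -> ~ hits x (h1 k) /\ ~ hits x (h2 k)).
  set (G := fun n v => forall K, exists x, ok K x /\ x n = v).
  assert (G0 : G O O).
  { intro K. destruct (finite_avoid p h1 h2 K) as [x Hx].
    - specialize (H1 K). specialize (H2 K). lra.
    - exists x. split; [exact Hx | apply (proj1 Hx)]. }
  assert (GS : forall n v, G n v ->
    exists w, (w / branching p n)%nat = v /\ G (S n) w).
  { intros n v HG. apply NNPP. intro Hno. pose proof (branching_pos p n) as Hb.
    (* If each child of [v] failed for some [K], finite branching would give one [K] failing for all
       of them; but the branch through [v] that is good for this [K] passes through a child. *)
    destruct (bounded_uniform
      (fun j K => ~ exists x, ok K x /\ x (S n) = (v * branching p n + j)%nat)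
      (branching p n)) as [K HK].
    - intros j K K' HKK' HQ [x [[Hx Hok] E]]. apply HQ. exists x.
      repeat split; [apply Hx | apply Hx | | | exact E]; apply Hok; lia.
    - intros j Hj. apply NNPP. intro HQ. apply Hno.
      exists (v * branching p n + j)%nat. split.
      + rewrite Nat.div_add_l by lia. rewrite Nat.div_small by assumption. lia.
      + intro K. apply NNPP. intro Hx. apply HQ. now exists K.
    - destruct (HG K) as [x [Hx E]].
      apply (HK (x (S n) mod branching p n)%nat).
      + apply Nat.mod_upper_bound. lia.
      + exists x. split; [exact Hx|]. rewrite <- E, <- (proj2 (proj1 Hx) n).
        pose proof (Nat.div_mod_eq (x (S n)) (branching p n)). lia. }
  set (next := fun n v => epsilon (inhabits O)
    (fun w => (w / branching p n)%nat = v /\ G (S n) w)).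
  set (x := fix x n := match n with O => O | S k => next k (x k) end).
  assert (HG : forall n, G n (x n) /\ (x (S n) / branching p n)%nat = x n).
  { induction n as [|n [IH _]].
    - split; [exact G0|]. apply (epsilon_spec (inhabits O) _ (GS _ _ G0)).
    - pose proof (epsilon_spec (inhabits O) _ (GS _ _ IH)) as [_ HGn].
      split; [exact HGn|]. apply (epsilon_spec (inhabits O) _ (GS _ _ HGn)). }
  exists x. split; [split; [reflexivity | apply HG]|].
  intro k. split; intro Hh.
  - destruct (proj1 (HG (clevel (h1 k))) k) as [y [[_ Hy] E]].
    apply (proj1 (Hy k (Nat.le_refl k))). unfold hits. now rewrite E.
  - destruct (proj1 (HG (clevel (h2 k))) k) as [y [[_ Hy] E]].
    apply (proj2 (Hy k (Nat.le_refl k))). unfold hits. now rewrite E.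
Qed.

(** * Values with thin fibres *)

Lemma functional_choice {A B : Type} (Q : A -> B -> Prop) :
  (forall a, exists b, Q a b) -> exists f : A -> B, forall a, Q a (f a).
Proof.
  intro H. exists (fun a => proj1_sig (constructive_indefinite_description _ (H a))).
  intro a. apply proj2_sig.
Qed.

(** Abstract trace of a Lipschitz function: [phi n v q] stands for a value between q/n! and (q+1)/n!
    taken below the node [v] of level [n], and [W] comes from the Lipschitz constant. *)
Definition consistent (p : nat) (phi : nat -> nat -> nat -> Prop) (W : nat) : Prop :=
  (forall n v q q', phi n v q -> phi n v q' -> (q <= q' + W)%nat) /\
  (forall n v q, phi (S n) v q -> phi n (v / branching p n)%nat (q / S n)%nat).

Definition fibre (p : nat) (phi : nat -> nat -> nat -> Prop) (n q : nat) : nat :=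
  cnt (fun v => phi n v q) (width p n).

(* Every node of level [n + 1] meets at most [W + 1] of the values [q (n + 1) + j],
   so at most [2 ^ p (W + 1)] of these values have a fibre of relative size
   exceeding [2 ^ - p] times that of [q]. *)
Lemma two_thin_values p phi W n q :
  consistent p phi W -> (2 ^ p * (W + 1) + 2 <= n)%nat ->
  exists j1 j2, (j1 + 2 <= j2)%nat /\ (j2 < S n)%nat /\ forall j, j = j1 \/ j = j2 ->
    (2 ^ p * fibre p phi (S n) (q * S n + j) <= branching p n * fibre p phi n q)%nat.
Proof.
  intros [Hspread Hpar] Hn.
  set (c := (branching p n * fibre p phi n q)%nat).
  set (f := fun j => fibre p phi (S n) (q * S n + j)).
  set (good := fun j => (2 ^ p * f j <= c)%nat).
  assert (Hsum : (nsum f (S n) <= (W + 1) * c)%nat).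
  { unfold f, fibre, c. unfold fibre.
    rewrite <- cnt_div by apply branching_pos. rewrite <- width_S.
    apply (nsum_cnt_le (fun j v => phi (S n) v (q * S n + j)%nat)).
    intros v _. destruct (classic (phi n (v / branching p n)%nat q)) as [H|H].
    - rewrite dec_true, Nat.mul_1_r by assumption. apply cnt_spread.
      intros i j _ _ Hi Hj. specialize (Hspread _ _ _ _ Hi Hj). lia.
    - rewrite cnt_none; [lia|]. intros j Hj Hphi. apply H.
      apply Hpar in Hphi. rewrite Nat.div_add_l, (Nat.div_small j) in Hphi by lia.
      now rewrite Nat.add_0_r in Hphi. }
  assert (Hbad : (cnt (fun j => ~ good j) (S n) <= 2 ^ p * (W + 1))%nat).
  (* The Markov bound is divided by [c]; if [c = 0], all the fibres counted by [f] are empty and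
     every offset is good. *)
  { destruct (Nat.eq_dec c 0) as [Hc|Hc].
    - rewrite cnt_none; [lia|]. intros j Hj Hg. apply Hg. unfold good.
      assert (Hf : (f j <= nsum f (S n))%nat).
      { clear -Hj. revert Hj. generalize (S n) as k0.
        induction k0 as [|k IH]; intro Hj; [lia|]. cbn.
        destruct (Nat.eq_dec j k) as [-> |]; [lia|]. assert (j < k)%nat as Hjk by lia. specialize (IH Hjk). lia. }
      rewrite Hc in *. nia.
    - pose proof (cnt_markov (fun j => ~ good j) f c (2 ^ p) (S n)) as Hm.
      assert (H : (cnt (fun j => ~ good j) (S n) * c <= 2 ^ p * nsum f (S n))%nat).
      { apply Hm. intros j _ Hj. unfold good in Hj. lia. }
      apply (Nat.mul_le_mono_pos_r _ _ c); [lia|]. nia. }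
  pose proof (cnt_not good (S n)) as Htot.
  apply NNPP. intro Hno.
  (* The bound on [n] leaves at least three good offsets, so two of them differ by at least 2. *)
  assert (cnt good (S n) <= 1 + 1)%nat; [|lia].
  apply cnt_spread. intros i j Hi Hj Hgi Hgj.
  destruct (le_lt_dec i (j + 1)) as [|Hlt]; [assumption|]. exfalso. apply Hno.
  exists j, i. repeat split; try lia. intros k [-> | ->]; assumption.
Qed.

Lemma nested_intervals (lo hi : nat -> R) :
  (forall n, lo n <= lo (S n)) -> (forall n, hi (S n) <= hi n) ->
  (forall n, lo n <= hi n) -> exists r, forall n, lo n <= r <= hi n.
Proof.
  intros Hlo Hhi Hle.
  assert (Hl : forall n k, lo n <= lo (k + n)%nat).
  { intros n k. induction k; cbn; [lra | eapply Rle_trans; eauto]. }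
  assert (Hh : forall n k, hi (k + n)%nat <= hi n).
  { intros n k. induction k; cbn; [lra | eapply Rle_trans; eauto]. }
  assert (Hlh : forall n m, lo n <= hi m).
  { intros n m. apply Rle_trans with (lo (m + n)%nat); [apply Hl|].
    apply Rle_trans with (hi (m + n)%nat); [apply Hle|].
    rewrite Nat.add_comm. apply Hh. }
  destruct (completeness (fun x => exists n, x = lo n)) as [r [Hub Hlub]].
  - exists (hi O). intros x [n ->]. apply Hlh.
  - exists (lo O), O. reflexivity.
  - exists r. intro n. split.
    + apply Hub. eauto.
    + apply Hlub. intros x [m ->]. apply Hlh.
Qed.

Lemma first_difference {A : Type} (x y : nat -> A) : x <> y ->
  exists n, x n <> y n /\ forall i, (i < n)%nat -> x i = y i.
Proof.
  intro Hne.
  assert (H : exists n, x n <> y n).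
  { apply NNPP. intro H. apply Hne, functional_extensionality. intro n.
    apply NNPP. intro Hn. apply H. eauto. }
  destruct H as [n Hn]. revert Hn.
  induction n as [n IH] using (well_founded_induction Nat.lt_wf_0). intro Hn.
  destruct (classic (exists i, (i < n)%nat /\ x i <> y i)) as [[i [Hi Hd]]|Hno].
  - exact (IH i Hi Hd).
  - exists n. split; [exact Hn|]. intros i Hi. apply NNPP. intro. apply Hno. eauto.
Qed.

(** The bound is the [p]-th power of the dyadic gauge at m+1, the length of the cylinders whose last
    coordinate has index [m]. *)
Definition small_codes (p : nat) (z : nat -> nat) : Prop :=
  forall m, mass p (z m) <= (/ 2 ^ S m) ^ p.

Definition in_window (r : R) (n q : nat) : Prop :=
  INR q <= r * INR (fact n) <= INR q + 1.

Lemma INR_fact_pos n : 0 < INR (fact n).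
Proof. apply lt_0_INR, lt_O_fact. Qed.

(* A Cantor scheme of values with thin fibres: [rr e] are the values, [zz e] codes
   the fibres of the approximations of [rr e], and [adm x e] says that every
   approximation of [rr e] is compatible with [x]. *)
Lemma thin_values p phi W : consistent p phi W ->
  exists (zz : (nat -> bool) -> nat -> nat) (rr : (nat -> bool) -> R)
         (adm : (nat -> nat) -> (nat -> bool) -> Prop),
    (forall e, small_codes p (zz e)) /\
    (forall x e e', adm x e -> adm x e' -> e = e') /\
    (forall x e, branch p x -> adm x e -> forall m, hits x (zz e m)) /\
    (forall e, 0 <= rr e <= 1) /\
    (forall x e, (forall n q, in_window (rr e) n q -> phi n (x n) q) -> adm x e) /\
    (forall e e', rr e = rr e' -> e = e').
Proof.
  intro Hcons. set (n0 := (2 ^ p * (W + 1) + 2)%nat).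
  assert (Hc : exists c : nat * nat -> nat * nat, forall nq, (n0 <= fst nq)%nat ->
    (fst (c nq) + 2 <= snd (c nq))%nat /\ (snd (c nq) < S (fst nq))%nat /\
    forall j, j = fst (c nq) \/ j = snd (c nq) ->
    (2 ^ p * fibre p phi (S (fst nq)) (snd nq * S (fst nq) + j)
       <= branching p (fst nq) * fibre p phi (fst nq) (snd nq))%nat).
  { apply (functional_choice (fun nq jj => (n0 <= fst nq)%nat ->
      (fst jj + 2 <= snd jj)%nat /\ (snd jj < S (fst nq))%nat /\
      forall j, j = fst jj \/ j = snd jj ->
      (2 ^ p * fibre p phi (S (fst nq)) (snd nq * S (fst nq) + j)
       <= branching p (fst nq) * fibre p phi (fst nq) (snd nq))%nat)).
    intro nq. destruct (le_lt_dec n0 (fst nq)) as [H|H].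
    - destruct (two_thin_values p phi W (fst nq) (snd nq) Hcons H) as [j1 [j2 Hj]].
      exists (j1, j2). intros _. exact Hj.
    - exists (O, O). lia. }
  destruct Hc as [c Hc].
  set (digit := fun n q (b : bool) => if b then snd (c (n, q)) else fst (c (n, q))).
  (* [qq e m] is a window index at level [m + n0], the level from which two thin refinements always
     exist; the bits of [e] choose between them. *)
  set (qq := fun (e : nat -> bool) => fix qq m := match m with
    | O => O
    | S k => (qq k * S (k + n0) + digit (k + n0)%nat (qq k) (e k))%nat end).
  assert (HqS : forall e m, qq e (S m) =
    (qq e m * S (m + n0) + digit (m + n0)%nat (qq e m) (e m))%nat) by reflexivity.
  assert (Hdig : forall m q b, (digit (m + n0)%nat q b < S (m + n0))%nat).
  { intros m q b. destruct (Hc (m + n0, q)%nat) as [H1 [H2 _]]; [cbn; lia|].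
    cbn [fst] in H2. unfold digit. destruct b; lia. }
  assert (Hfib : forall e m,
    ((2 ^ p) ^ m * fibre p phi (m + n0) (qq e m) <= width p (m + n0))%nat).
  { intros e m. induction m as [|m IH].
    - cbn [Nat.pow]. rewrite Nat.mul_1_l. apply cnt_bound.
    - destruct (Hc (m + n0, qq e m)%nat) as [_ [_ H]]; [cbn; lia|]. cbn [fst snd] in H.
      specialize (H (digit (m + n0)%nat (qq e m) (e m))
        ltac:(unfold digit; destruct (e m); auto)).
      change (S m + n0)%nat with (S (m + n0)). rewrite width_S, HqS.
      change ((2 ^ p) ^ S m)%nat with (2 ^ p * (2 ^ p) ^ m)%nat.
      set (F' := fibre p phi (S (m + n0)) _) in *. set (F := fibre p phi (m + n0) _) in *.
      nia. }
  (* Indices at distance 2 have disjoint windows, and refinement makes their gap grow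
     exponentially. *)
  assert (Hgrow : forall e e' m, (qq e m + 2 <= qq e' m)%nat ->
    forall j, (qq e (j + m) + 2 ^ j + 1 <= qq e' (j + m))%nat).
  { intros e e' m Hm j. induction j as [|j IH]; [cbn; lia|].
    change (S j + m)%nat with (S (j + m)). rewrite !HqS.
    pose proof (Hdig (j + m)%nat (qq e (j + m)%nat) (e (j + m)%nat)) as H.
    change (2 ^ S j)%nat with (2 * 2 ^ j)%nat.
    assert (2 <= S (j + m + n0))%nat by (unfold n0; lia).
    assert (1 <= 2 ^ j)%nat by (apply Nat.neq_0_lt_0, Nat.pow_nonzero; lia).
    nia. }
  assert (Hsep : forall e e', e <> e' -> exists m,
    (qq e m + 2 <= qq e' m)%nat \/ (qq e' m + 2 <= qq e m)%nat).
  { intros e e' Hne. destruct (first_difference e e' Hne) as [m [Hm Heq]].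
    assert (E : forall i, (i <= m)%nat -> qq e i = qq e' i).
    { induction i as [|i IH]; intro Hi; [reflexivity|].
      rewrite !HqS. now rewrite IH, Heq by lia. }
    exists (S m). rewrite !HqS, <- (E m) by lia.
    destruct (Hc (m + n0, qq e m)%nat) as [H _]; [cbn; lia|].
    unfold digit. destruct (e m), (e' m); try congruence; lia. }
  assert (Hr : exists rr : (nat -> bool) -> R, forall e m, in_window (rr e) (m + n0) (qq e m)).
  { apply (functional_choice (fun e r => forall m, in_window r (m + n0) (qq e m))).
    intro e.
    destruct (nested_intervals (fun m => INR (qq e m) / INR (fact (m + n0)))
                (fun m => (INR (qq e m) + 1) / INR (fact (m + n0)))) as [r Hr].
    - intro m. pose proof (INR_fact_pos (m + n0)) as Hf.
      change (S m + n0)%nat with (S (m + n0)).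
      rewrite HqS, fact_simpl, plus_INR, !mult_INR.
      pose proof (lt_0_INR (S (m + n0)) ltac:(lia)) as HB.
      pose proof (pos_INR (digit (m + n0)%nat (qq e m) (e m))) as Hd.
      apply (Rmult_le_reg_r (INR (S (m + n0)) * INR (fact (m + n0)))); [nra|].
      field_simplify; [|lra|lra]. nra.
    - intro m. pose proof (INR_fact_pos (m + n0)) as Hf.
      change (S m + n0)%nat with (S (m + n0)).
      rewrite HqS, fact_simpl, plus_INR, !mult_INR.
      pose proof (lt_0_INR (S (m + n0)) ltac:(lia)) as HB.
      pose proof (le_INR _ _ (Hdig m (qq e m) (e m))) as Hd.
      rewrite (S_INR (digit _ _ _)) in Hd.
      apply (Rmult_le_reg_r (INR (S (m + n0)) * INR (fact (m + n0)))); [nra|].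
      field_simplify; [|lra|lra]. nra.
    - intro m. pose proof (INR_fact_pos (m + n0)).
      apply Rmult_le_compat_r; [left; now apply Rinv_0_lt_compat | lra].
    - exists r. intro m. specialize (Hr m). cbn beta in Hr.
      pose proof (INR_fact_pos (m + n0)) as Hf. destruct Hr as [H1 H2].
      apply (Rmult_le_compat_r (INR (fact (m + n0)))) in H1; [|lra].
      apply (Rmult_le_compat_r (INR (fact (m + n0)))) in H2; [|lra].
      unfold Rdiv in *. rewrite Rmult_assoc, Rinv_l, Rmult_1_r in H1, H2 by lra.
      split; lra. }
  destruct Hr as [rr Hrr].
  (* The code with index [m] describes the fibre of stage m+1, since [small_codes] demands the gain
     of m+1 steps. *)
  destruct (functional_choice (fun (em : (nat -> bool) * nat) a =>
      clevel a = (S (snd em) + n0)%nat /\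
      forall v, (v < width p (S (snd em) + n0))%nat ->
        cset a v <-> phi (S (snd em) + n0)%nat v (qq (fst em) (S (snd em)))))
    as [zc Hzc].
  { intros [e m]. apply code_exists. }
  exists (fun e m => zc (e, m)), rr,
    (fun x e => forall m, phi (m + n0)%nat (x (m + n0)%nat) (qq e m)).
  refine (conj _ (conj _ (conj _ (conj _ (conj _ _))))).
  - intros e m. destruct (Hzc (e, m)) as [Hl Hs]. cbn [fst snd] in *.
    unfold mass. rewrite Hl, (cnt_ext _ _ _ Hs).
    pose proof (le_INR _ _ (Hfib e (S m))) as H. unfold fibre in H.
    rewrite mult_INR in H.
    assert (E : INR ((2 ^ p) ^ S m) = (2 ^ S m) ^ p).
    { rewrite <- Nat.pow_mul_r, Nat.mul_comm, Nat.pow_mul_r, !pow_INR. reflexivity. }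
    rewrite E in H. rewrite pow_inv.
    assert (0 < (2 ^ S m) ^ p) by (apply pow_lt, pow_lt; lra).
    pose proof (INR_width_pos p (S m + n0)).
    apply (Rmult_le_reg_r (INR (width p (S m + n0)))); [assumption|].
    unfold Rdiv. rewrite Rmult_assoc, Rinv_l, Rmult_1_r by lra.
    apply (Rmult_le_reg_l ((2 ^ S m) ^ p)); [assumption|].
    rewrite <- Rmult_assoc, Rinv_r, Rmult_1_l by lra. exact H.
  - intros x e e' He He'. apply NNPP. intro Hne.
    (* After [W] further refinements the gap exceeds the spread [W] allowed at one node, as 2^W >
       W. *)
    assert (Hgap : forall e e' m, (qq e m + 2 <= qq e' m)%nat ->
      (forall m, phi (m + n0)%nat (x (m + n0)%nat) (qq e m)) ->
      (forall m, phi (m + n0)%nat (x (m + n0)%nat) (qq e' m)) -> False).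
    { clear -Hgrow Hcons. intros e e' m Hm He He'.
      specialize (Hgrow e e' m Hm W).
      pose proof (proj1 Hcons _ _ _ _ (He' (W + m)%nat) (He (W + m)%nat)).
      pose proof (Nat.pow_gt_lin_r 2 W). lia. }
    destruct (Hsep e e' Hne) as [m [H|H]]; eauto.
  - intros x e Hx Hadm m. unfold hits. destruct (Hzc (e, m)) as [Hl Hs].
    rewrite Hl. apply Hs; [now apply branch_lt|]. apply (Hadm (S m)).
  - intro e. destruct (Hrr e O) as [H1 H2]. cbn [qq Nat.add INR] in H1, H2.
    pose proof (le_INR 1 (fact n0) (lt_O_fact n0)) as Hf. cbn [INR] in Hf. split; nra.
  - intros x e H m. apply H, Hrr.
  - intros e e' Hre. apply NNPP. intro Hne.
    assert (Hgap : forall e e' m, (qq e m + 2 <= qq e' m)%nat -> rr e = rr e' -> False).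
    { clear -Hrr. intros e e' m Hm E. destruct (Hrr e m) as [_ H1].
      destruct (Hrr e' m) as [H2 _]. rewrite E in H1. apply le_INR in Hm.
      rewrite plus_INR in Hm. cbn [INR] in Hm. lra. }
    destruct (Hsep e e' Hne) as [m [H|H]]; eauto.
Qed.

(** * Transfinite construction *)

(** Lengths of at least 1 give each cylinder a last coordinate, which is later read as a code. *)
Definition cyl_cover (rho : nat -> R) (p : nat) (eps : R) (S : (nat -> nat) -> Prop) : Prop :=
  exists (z : nat -> nat -> nat) (n : nat -> nat),
    (forall k, (1 <= n k)%nat) /\
    (forall K, sum_f_R0 (fun k => rho (n k) ^ p) K <= eps) /\
    (forall x, S x -> exists k, forall i, (i < n k)%nat -> x i = z k i).

(** Even bits hold a relation and odd bits a sequence, so one enumeration of the Cantor set runs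
    through all functions and all covers. *)
Definition coded_rel (e : nat -> bool) (n v q : nat) : Prop :=
  e (2 * Cantor.to_nat (n, Cantor.to_nat (v, q)))%nat = true.

Definition coded_graph (e : nat -> bool) (h : nat -> nat) : Prop :=
  forall j m, e (S (2 * Cantor.to_nat (j, m)))%nat = true <-> h j = m.

Lemma coded_exists (phi : nat -> nat -> nat -> Prop) (h : nat -> nat) :
  exists e, (forall n v q, coded_rel e n v q <-> phi n v q) /\ coded_graph e h.
Proof.
  destruct (functional_choice (fun i (b : bool) => b = true <->
    (exists n v q, i = (2 * Cantor.to_nat (n, Cantor.to_nat (v, q)))%nat /\ phi n v q) \/
    (exists j, i = S (2 * Cantor.to_nat (j, h j))))) as [e He].
  { intro i. match goal with |- exists b, _ <-> ?P => destruct (classic P) as [H|H] end.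
    - exists true. tauto.
    - exists false. split; [discriminate | tauto]. }
  exists e. split.
  - intros n v q. unfold coded_rel. rewrite He. split.
    + intros [[n' [v' [q' [E H]]]] | [j E]]; [|lia].
      assert (E' : Cantor.to_nat (n, Cantor.to_nat (v, q))
                 = Cantor.to_nat (n', Cantor.to_nat (v', q'))) by lia.
      apply Cantor.to_nat_inj in E'.
      pose proof (f_equal fst E') as E1. apply (f_equal snd) in E'. cbn [fst snd] in *.
      apply Cantor.to_nat_inj in E'. injection E' as -> ->. now subst.
    + intro H. left. now exists n, v, q.
  - intros j m. rewrite He. split.
    + intros [[n' [v' [q' [E H]]]] | [j' E]]; [lia|].
      assert (E' : Cantor.to_nat (j, m) = Cantor.to_nat (j', h j')) by lia.
      apply Cantor.to_nat_inj in E'. now injection E' as -> ->.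
    + intros <-. right. now exists j.
Qed.

Lemma empty_code p : exists a, mass p a = 0 /\ forall x, branch p x -> ~ hits x a.
Proof.
  destruct (code_exists 0 (width p 0) (fun _ => False)) as [a [Hl Hs]].
  exists a. split.
  - unfold mass. rewrite Hl, cnt_none; [cbn [INR]; apply Rmult_0_l|].
    intros i Hi. rewrite Hs by assumption. tauto.
  - intros x Hx. unfold hits. rewrite Hl, Hs by now apply branch_lt. tauto.
Qed.

(** Adding the endpoint costs one bit: the tail of [e] differs from the tails of all earlier [f b],
    its first bit from that of [f a]. *)
Lemma closed_segment_small (I : Type) (lt : I -> I -> Prop) :
  (forall a (f : I -> nat -> bool), exists e, forall b, lt b a -> f b <> e) ->
  forall a (f : I -> nat -> bool), exists e, forall b, lt b a \/ b = a -> f b <> e.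
Proof.
  intros Hsm a f. destruct (Hsm a (fun b n => f b (S n))) as [e He].
  exists (fun n => match n with O => negb (f a O) | S k => e k end).
  intros b [Hb | ->] E.
  - apply (He b Hb). now rewrite E.
  - apply (f_equal (fun g => g O)) in E. now destruct (f a O).
Qed.

(* Transfinite recursion: stage [a] produces a point avoiding the cover coded by
   [enum a] and all level sets excluded so far, together with a value [r] (and
   codes for its fibres) that the function coded by [enum a] does not take at any
   point chosen up to stage [a]. The cover of the family of codes chosen so far
   is turned into countably many small sets catching all excluded level sets. *)
Lemma positive_set_missing_values p (I : Type) (lt : I -> I -> Prop)
    (enum : I -> nat -> bool) :
  well_founded lt -> (forall a b, lt a b \/ a = b \/ lt b a) ->
  (forall e, exists a, enum a = e) ->
  (forall a (f : I -> nat -> bool), exists e, forall b, lt b a -> f b <> e) ->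
  (forall a (zf : I -> nat -> nat),
     cyl_cover (fun n => / 2 ^ n) p (1 / 4) (fun x => exists b, lt b a /\ x = zf b)) ->
  exists X : (nat -> nat) -> Prop,
    (forall x, X x -> branch p x) /\
    (forall h, (forall K, sum_f_R0 (fun k => mass p (h k)) K <= 1 / 2) ->
       exists x, X x /\ forall k, ~ hits x (h k)) /\
    (forall phi W, consistent p phi W -> exists r, 0 <= r <= 1 /\
       forall x, X x -> ~ (forall n q, in_window r n q -> phi n (x n) q)).
Proof.
  intros wf tri Hen Hsm Hcov.
  set (D := ((nat -> nat) * (nat -> nat) * R)%type).
  set (px := fun d : D => fst (fst d)). set (pz := fun d : D => snd (fst d)).
  (* A stage holds a point, the codes of the fibres and a value. The third clause protects earlier
     values from the new point, the fourth protects the new value from all points chosen so far, the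
     new one included. *)
  set (P := fun a (F : I -> D) (d : D) =>
    branch p (px d) /\
    (forall h, coded_graph (enum a) h ->
       (forall K, sum_f_R0 (fun k => mass p (h k)) K <= 1 / 2) ->
       forall k, ~ hits (px d) (h k)) /\
    (forall b, lt b a -> small_codes p (pz (F b)) ->
       exists m, ~ hits (px d) (pz (F b) m)) /\
    ((exists W, consistent p (coded_rel (enum a)) W) ->
       small_codes p (pz d) /\ 0 <= snd d <= 1 /\
       forall y, branch p y ->
         (forall n q, in_window (snd d) n q -> coded_rel (enum a) n (y n) q) ->
         (forall m, hits y (pz d m)) /\ y <> px d /\
         forall b, lt b a -> y <> px (F b))).
  destruct (wf_choice_recursion I D (fun _ => O, fun _ => O, 0) lt P) as [F HF].
  - exact wf.
  - intros a f g d Hfg (H1 & H2 & H3 & H4). refine (conj H1 (conj H2 (conj _ _))).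
    + intros b Hb. rewrite <- (Hfg b Hb). auto.
    + intro HW. destruct (H4 HW) as (H5 & H6 & H7). refine (conj H5 (conj H6 _)).
      intros y Hy Hw. destruct (H7 y Hy Hw) as (H8 & H9 & H10).
      refine (conj H8 (conj H9 _)). intros b Hb. rewrite <- (Hfg b Hb). auto.
  - intros a F.
    destruct (empty_code p) as [a0 [Ha0 Hhits0]].
    assert (Hh : exists h1, (forall K, sum_f_R0 (fun k => mass p (h1 k)) K <= 1 / 2) /\
      forall h, coded_graph (enum a) h ->
       (forall K, sum_f_R0 (fun k => mass p (h k)) K <= 1 / 2) -> h = h1).
    { destruct (classic (exists h, coded_graph (enum a) h /\
        (forall K, sum_f_R0 (fun k => mass p (h k)) K <= 1 / 2))) as [[h1 [Hg Hs]] | Hno].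
      - exists h1. split; [exact Hs|]. intros h Hh _.
        apply functional_extensionality. intro j.
        specialize (Hg j (h j)). specialize (Hh j (h j)). symmetry. tauto.
      - exists (fun _ => a0). split.
        + intro K. rewrite (sum_eq _ (fun _ => 0)) by auto.
          rewrite sum_cte. lra.
        + intros h Hg Hs. exfalso. eauto. }
    destruct Hh as [h1 [Hs1 Hh1]].
    destruct (Hcov a (fun b => pz (F b))) as [z [n [Hn [Hs2 Hc]]]].
    (* [h2 k] is the last coordinate of the [k]-th cylinder if its mass is small enough, as it is
       when the cylinder contains a sequence in [small_codes]; otherwise it is the empty code. *)
    destruct (functional_choice (fun k c => mass p c <= (/ 2 ^ n k) ^ p /\
        (mass p (z k (n k - 1)%nat) <= (/ 2 ^ n k) ^ p -> c = z k (n k - 1)%nat)))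
      as [h2 Hh2].
    { intro k. destruct (Rle_dec (mass p (z k (n k - 1)%nat)) ((/ 2 ^ n k) ^ p)) as [H|H].
      - eauto.
      - exists a0. split; [|tauto]. rewrite Ha0. left.
        apply pow_lt, Rinv_0_lt_compat, pow_lt. lra. }
    destruct (branch_avoid p h1 h2 (1 / 2) (1 / 4)) as [x [Hx Hav]]; [lra | exact Hs1 | |].
    { intro K. refine (Rle_trans _ _ _ _ (Hs2 K)). apply sum_Rle.
      intros k _. apply (Hh2 k). }
    assert (HxF : forall b, lt b a -> small_codes p (pz (F b)) ->
       exists m, ~ hits x (pz (F b) m)).
    { intros b Hb Hsmall. destruct (Hc (pz (F b))) as [k Hk]; [eauto|].
      exists (n k - 1)%nat. specialize (Hn k). rewrite Hk by lia.
      destruct (Hh2 k) as [_ E]. rewrite <- E; [apply Hav|].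
      rewrite <- Hk by lia. specialize (Hsmall (n k - 1)%nat).
      now replace (S (n k - 1)) with (n k) in Hsmall by lia. }
    destruct (classic (exists W, consistent p (coded_rel (enum a)) W)) as [HW|HW].
    2:{ exists (x, fun _ => O, 0). refine (conj Hx (conj _ (conj HxF _))).
        - intros h Hg Hs k. rewrite (Hh1 h Hg Hs). apply Hav.
        - tauto. }
    destruct HW as [W HW].
    destruct (thin_values p _ W HW) as (zz & rr & adm & Hz & Huniq & Hhit & H01 & Hadm & _).
    set (pt := fun b => if excluded_middle_informative (b = a) then x else px (F b)).
    (* Each point chosen so far is compatible with at most one [e], and these points are too few to
       use up the Cantor set. *)
    destruct (closed_segment_small I lt Hsm a (fun b => epsilon (inhabits (fun _ => true))
       (fun e => adm (pt b) e))) as [e He].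
    assert (Hne : forall b, lt b a \/ b = a -> ~ adm (pt b) e).
    { intros b Hb H. apply (He b Hb). apply (Huniq (pt b)); [|exact H].
      apply epsilon_spec. eauto. }
    exists (x, zz e, rr e). refine (conj Hx (conj _ (conj HxF _))).
    + intros h Hg Hs k. rewrite (Hh1 h Hg Hs). apply Hav.
    + intros _. refine (conj (Hz e) (conj (H01 e) _)).
      intros y Hy Hw. specialize (Hadm y e Hw). refine (conj _ (conj _ _)).
      * now apply Hhit.
      * intros ->. apply (Hne a); [auto|]. unfold pt.
        now destruct (excluded_middle_informative (a = a)).
      * intros b Hb ->. apply (Hne b); [auto|]. unfold pt.
        destruct (excluded_middle_informative (b = a)) as [E|]; [|exact Hadm].
        subst b. exfalso. clear -Hb wf. induction (wf a) as [a _ IH]. eauto.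
  - exists (fun x => exists a, x = px (F a)). refine (conj _ (conj _ _)).
    + intros x [a ->]. apply (HF a).
    + intros h Hs. destruct (coded_exists (fun _ _ _ => False) h) as [e [_ Hg]].
      destruct (Hen e) as [a <-]. exists (px (F a)). split; [eauto|].
      apply (HF a); assumption.
    + intros phi W HW. destruct (coded_exists phi (fun _ => O)) as [e [He _]].
      destruct (Hen e) as [a <-].
      destruct (HF a) as (_ & _ & _ & Ha). destruct Ha as (Hsmall & Hr & Hy).
      { exists W. destruct HW as [Hsp Hpar]. split.
        - intros n v q q'. rewrite !He. apply Hsp.
        - intros n v q. rewrite !He. apply Hpar. }
      exists (snd (F a)). split; [exact Hr|]. intros x [b ->] Hw.
      destruct (HF b) as (Hbr & _ & Hav & _).
      destruct (Hy (px (F b)) Hbr) as (Hbad & Hna & Hlt).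
      { intros n q Hq. apply He, Hw, Hq. }
      (* Points of stages after [a] escape one of the coded fibres; points of stages up to [a] were
         excluded when the value was chosen. *)
      destruct (tri a b) as [Hab | [<- | Hba]].
      * destruct (Hav a Hab Hsmall) as [m Hm]. apply Hm, Hbad.
      * now apply Hna.
      * now apply (Hlt b Hba).
Qed.

(** * Ultrametric spaces of sequences *)

(** [rho n] serves as the distance of sequences first differing at [n]. Weak monotonicity admits
    [fact_gauge], which repeats the value 1. *)
Definition gauge (rho : nat -> R) : Prop :=
  (forall n, 0 < rho n) /\ (forall n, rho (S n) <= rho n) /\ rho O = 1 /\
  (forall eps, 0 < eps -> exists n, rho n < eps).

Lemma gauge_antitone rho m n : gauge rho -> (m <= n)%nat -> rho n <= rho m.
Proof.
  intros (_ & Hd & _) Hmn. induction Hmn as [|n _ IH]; [lra|].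
  eapply Rle_trans; eauto.
Qed.

Definition first_diff (x y : nat -> nat) (n : nat) : Prop :=
  x n <> y n /\ forall i, (i < n)%nat -> x i = y i.

Lemma first_diff_cases x y : x = y \/ exists n, first_diff x y n.
Proof.
  destruct (classic (x = y)) as [|H]; [now left|]. right. now apply first_difference.
Qed.

Definition udist (rho : nat -> R) (x y : nat -> nat) : R :=
  match excluded_middle_informative (exists n, first_diff x y n) with
  | left H => rho (proj1_sig (constructive_indefinite_description _ H))
  | right _ => 0
  end.

Lemma udist_diff rho x y n : first_diff x y n -> udist rho x y = rho n.
Proof.
  intros [Hn Hlt]. unfold udist.
  destruct (excluded_middle_informative _) as [H|H].
  - destruct (constructive_indefinite_description _ H) as [m [Hm Hltm]]. cbn. f_equal.
    destruct (Nat.lt_trichotomy m n) as [L | [E | L]]; [|exact E|].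
    + now specialize (Hlt m L).
    + now specialize (Hltm n L).
  - destruct H. now exists n.
Qed.

Lemma udist_refl rho x : udist rho x x = 0.
Proof.
  unfold udist. destruct (excluded_middle_informative _) as [H|]; [|reflexivity].
  exfalso. destruct H as [n [Hn _]]. now apply Hn.
Qed.

Lemma udist_nonneg rho x y : gauge rho -> 0 <= udist rho x y.
Proof.
  intros (Hpos & _). destruct (first_diff_cases x y) as [-> | [n Hn]].
  - rewrite udist_refl. lra.
  - rewrite (udist_diff _ _ _ _ Hn). left. apply Hpos.
Qed.

Lemma udist_agree rho x y n : gauge rho ->
  (forall i, (i < n)%nat -> x i = y i) -> udist rho x y <= rho n.
Proof.
  intros Hg Hlt. destruct (first_diff_cases x y) as [-> | [m Hm]].
  - rewrite udist_refl. left. apply Hg.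
  - rewrite (udist_diff _ _ _ _ Hm). apply gauge_antitone; [exact Hg|].
    destruct (le_lt_dec n m) as [|L]; [assumption|].
    now destruct (proj1 Hm (Hlt m L)).
Qed.

Lemma udist_sym rho x y : udist rho x y = udist rho y x.
Proof.
  destruct (first_diff_cases x y) as [-> | [n Hn]]; [reflexivity|].
  rewrite (udist_diff _ _ _ _ Hn). symmetry. apply udist_diff.
  destruct Hn as [H1 H2]. split; [congruence|]. intros i Hi. symmetry. auto.
Qed.

Lemma udist_tri rho x y z : gauge rho ->
  udist rho x z <= udist rho x y + udist rho y z.
Proof.
  intro Hg. pose proof (udist_nonneg rho x y Hg). pose proof (udist_nonneg rho y z Hg).
  destruct (first_diff_cases x y) as [-> | [n Hn]]; [lra|].
  destruct (first_diff_cases y z) as [-> | [m Hm]]; [lra|].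
  assert (Hle : udist rho x z <= rho (Nat.min n m)).
  { apply udist_agree; [exact Hg|]. intros i Hi.
    rewrite (proj2 Hn), (proj2 Hm) by lia. reflexivity. }
  rewrite (udist_diff _ _ _ _ Hn), (udist_diff _ _ _ _ Hm) in *.
  destruct (Nat.min_dec n m) as [E|E]; rewrite E in Hle; lra.
Qed.

Lemma udist_eq0 rho (X : (nat -> nat) -> Prop) (x y : {x | X x}) : gauge rho ->
  udist rho (proj1_sig x) (proj1_sig y) = 0 <-> x = y.
Proof.
  intro Hg. split; [|intros ->; apply udist_refl].
  destruct x as [x Hx], y as [y Hy]. cbn. intro E.
  destruct (first_diff_cases x y) as [-> | [n Hn]].
  - f_equal. apply proof_irrelevance.
  - rewrite (udist_diff _ _ _ _ Hn) in E. pose proof (proj1 Hg n). lra.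
Qed.

Definition uspace (rho : nat -> R) (Hg : gauge rho) (X : (nat -> nat) -> Prop) : MetricSpace :=
  {| carrier := {x | X x};
     dist := fun x y => udist rho (proj1_sig x) (proj1_sig y);
     dist_nonneg := fun x y => udist_nonneg rho _ _ Hg;
     dist_eq0 := fun x y => udist_eq0 rho X x y Hg;
     dist_sym := fun x y => udist_sym rho _ _;
     dist_tri := fun x y z => udist_tri rho _ _ _ Hg |}.

Fixpoint prefix_code (x : nat -> nat) (n : nat) : nat :=
  match n with O => O | S k => Cantor.to_nat (x k, prefix_code x k) end.

Lemma prefix_code_inj x y n : prefix_code x n = prefix_code y n ->
  forall i, (i < n)%nat -> x i = y i.
Proof.
  induction n as [|n IH]; intros E i Hi; [lia|]. cbn [prefix_code] in E.
  apply Cantor.to_nat_inj in E.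
  pose proof (f_equal fst E) as E1. apply (f_equal snd) in E. cbn [fst snd] in *.
  destruct (Nat.eq_dec i n) as [-> |]; [exact E1 | apply IH; [exact E | lia]].
Qed.

(** One point is picked from each cylinder meeting [X]; cylinders are numbered by length and prefix
    code. *)
Lemma uspace_separable rho Hg X : (exists x, X x) -> separable (uspace rho Hg X).
Proof.
  intros [x0 Hx0].
  destruct (functional_choice (fun (nc : nat * nat) (d : {x | X x}) =>
    forall x, X x -> prefix_code x (fst nc) = snd nc ->
      prefix_code (proj1_sig d) (fst nc) = snd nc)) as [pick Hpick].
  { intros [n c]. cbn.
    destruct (classic (exists x, X x /\ prefix_code x n = c)) as [[x [Hx E]] | Hno].
    - now exists (exist _ x Hx).
    - exists (exist _ x0 Hx0). intros x Hx E. exfalso. eauto. }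
  exists (fun d => exists nc, d = pick nc). split.
  - exists (fun d => epsilon (inhabits O) (fun k => d = pick (Cantor.of_nat k))).
    assert (Hd : forall d, (exists nc, d = pick nc) ->
      d = pick (Cantor.of_nat (epsilon (inhabits O) (fun k => d = pick (Cantor.of_nat k))))).
    { intros d [nc E]. apply epsilon_spec. exists (Cantor.to_nat nc).
      now rewrite Cantor.cancel_of_to. }
    intros x y Hx Hy E. rewrite (Hd x Hx), (Hd y Hy). cbn in E. now rewrite E.
  - intros [x Hx] eps Heps. pose proof Hg as (_ & _ & _ & Hlim).
    destruct (Hlim eps Heps) as [n Hn].
    exists (pick (n, prefix_code x n)). split; [eauto|]. cbn.
    refine (Rle_lt_trans _ _ _ _ Hn). apply udist_agree; [exact Hg|].
    apply prefix_code_inj. symmetry.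
    exact (Hpick (n, prefix_code x n) x Hx eq_refl).
Qed.

(** * Hausdorff-null sets and cylinder covers *)

Lemma dist_le_diam {X : MetricSpace} (U : X -> Prop) x y :
  bounded_set U -> U x -> U y -> dist x y <= diam U.
Proof.
  intros Hb Hx Hy. unfold diam.
  destruct (excluded_middle_informative _) as [H|H].
  - apply (proj1 (proj2_sig (completeness _ _ _))). now exists x, y.
  - destruct H. eauto.
Qed.

Lemma hpow_nonneg {X : MetricSpace} (U : X -> Prop) t : 0 <= hpow U t.
Proof.
  unfold hpow. destruct (excluded_middle_informative _); [|lra].
  destruct (Req_EM_T _ _); [destruct (Req_EM_T _ _); lra|].
  left. apply exp_pos.
Qed.

Lemma pow_le_Rpower d t p : 0 < d <= 1 -> t <= INR p -> d ^ p <= Rpower d t.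
Proof.
  intros Hd Ht. rewrite <- Rpower_pow by tauto. unfold Rpower.
  assert (Hln : ln d <= 0).
  { rewrite <- ln_1. destruct (proj2 Hd) as [H | ->]; [left; apply ln_increasing; tauto | lra]. }
  assert (H : INR p * ln d <= t * ln d) by nra.
  destruct H as [H | ->]; [left; now apply exp_increasing | lra].
Qed.

Lemma small_pow rho p eps : gauge rho -> (1 <= p)%nat -> 0 < eps ->
  exists n, (1 <= n)%nat /\ rho n ^ p <= eps.
Proof.
  intros Hg Hp Heps. pose proof Hg as (Hpos & Hd & H0 & Hlim).
  destruct (Hlim eps Heps) as [n Hn]. exists (S n). split; [lia|].
  assert (H1 : rho (S n) <= 1) by (rewrite <- H0; apply gauge_antitone; [exact Hg | lia]).
  assert (Hpp : forall j, 0 <= rho (S n) ^ j <= 1).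
  { intro j. pose proof (pow_le (rho (S n)) j (Rlt_le _ _ (Hpos (S n)))).
    split; [assumption|]. rewrite <- (pow1 j). apply pow_incr.
    split; [left; apply Hpos | exact H1]. }
  destruct p as [|j]; [lia|]. cbn. specialize (Hpp j). specialize (Hd n).
  pose proof (Hpos (S n)). nra.
Qed.

(** The cylinder is cut at the least index where two points of [U] differ, so [rho n] is at most the
    diameter. If [U] has at most one point, a long cylinder is paid for by [eps]. *)
Lemma one_cylinder rho Hg X p t eps (U : uspace rho Hg X -> Prop) :
  (1 <= p)%nat -> t <= INR p -> 0 < eps -> diam U <= 1 / 2 -> bounded_set U ->
  exists (z : nat -> nat) n, (1 <= n)%nat /\ rho n ^ p <= hpow U t + eps /\
    forall x : uspace rho Hg X, U x -> forall i, (i < n)%nat -> proj1_sig x i = z i.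
Proof.
  intros Hp Ht Heps Hdiam Hb. pose proof (hpow_nonneg U t) as Hnn.
  destruct (classic (exists n, exists x y : uspace rho Hg X,
    U x /\ U y /\ first_diff (proj1_sig x) (proj1_sig y) n)) as [[n0 Hn0]|Hno].
  - assert (Hleast : exists n, (exists x y : uspace rho Hg X,
        U x /\ U y /\ first_diff (proj1_sig x) (proj1_sig y) n) /\
        forall m, (m < n)%nat -> ~ exists x y : uspace rho Hg X,
        U x /\ U y /\ first_diff (proj1_sig x) (proj1_sig y) m).
    { revert Hn0. induction n0 as [n IH] using (well_founded_induction Nat.lt_wf_0).
      intro Hn. destruct (classic (exists m, (m < n)%nat /\ exists x y : uspace rho Hg X,
        U x /\ U y /\ first_diff (proj1_sig x) (proj1_sig y) m)) as [[m [Hm Hxy]]|Hno].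
      - exact (IH m Hm Hxy).
      - exists n. split; [exact Hn|]. intros m Hm Hxy. apply Hno. eauto. }
    destruct Hleast as [n [[x [y [Hx [Hy Hd]]]] Hmin]].
    assert (Hrho : rho n <= diam U).
    { rewrite <- (udist_diff rho _ _ _ Hd). exact (dist_le_diam U x y Hb Hx Hy). }
    pose proof (proj1 Hg n) as Hpos.
    exists (proj1_sig x), n. repeat split.
    (* Index 0 would force diameter at least [rho 0 = 1], against the bound 1/2. *)
    + destruct n; [|lia]. pose proof Hg as (_ & _ & H0 & _). lra.
    + enough (rho n ^ p <= hpow U t) by lra.
      unfold hpow. destruct (excluded_middle_informative _) as [_|H]; [|destruct H; eauto].
      destruct (Req_EM_T _ _) as [E|_]; [lra|].
      apply Rle_trans with (diam U ^ p); [apply pow_incr; lra|].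
      apply pow_le_Rpower; [lra | exact Ht].
    + intros w Hw i Hi.
      destruct (first_diff_cases (proj1_sig w) (proj1_sig x)) as [-> | [m Hm]]; [reflexivity|].
      apply (proj2 Hm). destruct (le_lt_dec n m) as [|L]; [lia|].
      exfalso. apply (Hmin m L). now exists w, x.
  - destruct (small_pow rho p eps Hg Hp Heps) as [n [Hn Hs]].
    destruct (classic (exists x, U x)) as [[x Hx]|He].
    + exists (proj1_sig x), n. repeat split; [exact Hn | lra |].
      intros w Hw i Hi.
      destruct (first_diff_cases (proj1_sig w) (proj1_sig x)) as [-> | [m Hm]]; [reflexivity|].
      exfalso. apply Hno. now exists m, w, x.
    + exists (fun _ => O), n. repeat split; [exact Hn | lra |].
      intros w Hw. exfalso. eauto.
Qed.

Lemma sum_half_pow K : sum_f_R0 (fun k => (/ 2) ^ S k) K = 1 - (/ 2) ^ S K.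
Proof.
  induction K as [|K IH]; [cbn; lra|].
  rewrite tech5, IH. cbn [pow]. lra.
Qed.

(** Passing from the [k]-th covering set to a cylinder costs at most eps/2 times 2^-(k+1), in total
    less than eps/2. *)
Lemma null_cyl_cover rho Hg X p t eps :
  (1 <= p)%nat -> t <= INR p -> 0 < eps ->
  hausdorff_measure_zero (uspace rho Hg X) t -> cyl_cover rho p eps X.
Proof.
  intros Hp Ht Heps Hnull.
  destruct (Hnull (1 / 2) ltac:(lra) (eps / 2) ltac:(lra)) as [U [Hcov [Hd Hsum]]].
  destruct (functional_choice (fun k (zn : (nat -> nat) * nat) => (1 <= snd zn)%nat /\
    rho (snd zn) ^ p <= hpow (U k) t + eps / 2 * (/ 2) ^ S k /\
    forall x : uspace rho Hg X, U k x ->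
      forall i, (i < snd zn)%nat -> proj1_sig x i = fst zn i)) as [zn Hzn].
  { intro k. assert (0 < eps / 2 * (/ 2) ^ S k).
    { apply Rmult_lt_0_compat; [lra | apply pow_lt; lra]. }
    destruct (one_cylinder rho Hg X p t _ (U k) Hp Ht H (proj1 (Hd k)) (proj2 (Hd k)))
      as [z [n Hzn]]. now exists (z, n). }
  exists (fun k => fst (zn k)), (fun k => snd (zn k)). refine (conj _ (conj _ _)).
  - intro k. apply (Hzn k).
  - intro K. apply Rle_trans with
      (sum_f_R0 (fun k => hpow (U k) t + (/ 2) ^ S k * (eps / 2)) K).
    + apply sum_Rle. intros k _. rewrite (Rmult_comm (_ ^ _)). apply (Hzn k).
    + rewrite sum_plus, <- scal_sum, sum_half_pow.
      specialize (Hsum K). assert (0 < (/ 2) ^ S K) by (apply pow_lt; lra). nra.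
  - intros x Hx. destruct (Hcov (exist _ x Hx)) as [k Hk]. exists k.
    exact (proj2 (proj2 (Hzn k)) _ Hk).
Qed.

(* If the distance to a point of the image misses a value [r] below the radius of a neighbourhood,
   then the ball of radius [r] is clopen in the image. *)
Lemma lipschitz_image_ind_le_0 (X : MetricSpace) :
  (forall (Y : X -> Prop) (g : {x : X | Y x} -> R) L, 0 <= L ->
     (forall a b, Rabs (g a - g b) <= L * dist (proj1_sig a) (proj1_sig b)) ->
     exists r, 0 <= r <= 1 /\ forall a, g a <> r) ->
  forall (Y : X -> Prop) (Z : MetricSpace) (f : {x : X | Y x} -> Z),
    lipschitz_on Y f -> ind_le_0 (image_of Y f).
Proof.
  intros Hmiss Y Z f [L [HL Hf]] z0 Hz0 W [HWA HWopen] HWz.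
  destruct (HWopen z0 HWz) as [d [Hd HWd]].
  (* The affine change sends the values 0 and 1 to the radii d/3 and 2d/3, so the missed radius is
     positive and below [d]. *)
  destruct (Hmiss Y (fun a => 3 * dist z0 (f a) / d - 1) (3 * L / d)) as [r [Hr Hne]].
  { apply Rmult_le_pos; [lra | left; now apply Rinv_0_lt_compat]. }
  { intros a b. specialize (Hf a b).
    replace (3 * dist z0 (f a) / d - 1 - (3 * dist z0 (f b) / d - 1))
      with (3 / d * (dist z0 (f a) - dist z0 (f b))) by (field; lra).
    rewrite Rabs_mult, (Rabs_pos_eq (3 / d)).
    2:{ apply Rmult_le_pos; [lra | left; now apply Rinv_0_lt_compat]. }
    replace (3 * L / d * dist (proj1_sig a) (proj1_sig b))
      with (3 / d * (L * dist (proj1_sig a) (proj1_sig b))) by (field; lra).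
    apply Rmult_le_compat_l.
    { apply Rmult_le_pos; [lra | left; now apply Rinv_0_lt_compat]. }
    refine (Rle_trans _ _ _ _ Hf). apply Rabs_le.
    pose proof (dist_tri Z z0 (f a) (f b)). pose proof (dist_tri Z z0 (f b) (f a)).
    rewrite (dist_sym Z (f b) (f a)) in *. lra. }
  set (s := (r + 1) * d / 3).
  assert (Hs : 0 < s < d) by (unfold s; split; nra).
  assert (Hgap : forall w, image_of Y f w -> dist z0 w <> s).
  { intros w [a <-] E. apply (Hne a). rewrite E. unfold s. field. lra. }
  assert (Hz : dist z0 z0 = 0) by now apply dist_eq0.
  exists (fun w => image_of Y f w /\ dist z0 w < s). refine (conj (conj _ _) (conj _ (conj _ _))).
  - tauto.
  - intros w [Hw Hlt]. exists (s - dist z0 w). split; [lra|].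
    intros w' Hw' Hd'. split; [exact Hw'|]. pose proof (dist_tri Z z0 w w'). lra.
  - split; [exact Hz0 | lra].
  - intros w [Hw Hlt]. apply HWd; [exact Hw | lra].
  - intros w [[Hw Hcl] Hint]. pose proof (Hgap w Hw) as Hgw.
    destruct (Rlt_le_dec (dist z0 w) s) as [Hlt|Hge].
    + apply Hint. split; [exact Hw|]. exists (s - dist z0 w). split; [lra|].
      intros w' Hw' Hd'. split; [exact Hw'|]. pose proof (dist_tri Z z0 w w'). lra.
    + destruct (Hcl (dist z0 w - s)) as [w' [[_ Hlt] [_ Hd']]]; [lra|].
      pose proof (dist_tri Z z0 w' w). rewrite (dist_sym Z w' w) in *. lra.
Qed.

Lemma tHD_eq_0_of_missing_values (X : MetricSpace) :
  (exists _ : X, True) ->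
  (forall (Y : X -> Prop) (g : {x : X | Y x} -> R) L, 0 <= L ->
     (forall a b, Rabs (g a - g b) <= L * dist (proj1_sig a) (proj1_sig b)) ->
     exists r, 0 <= r <= 1 /\ forall a, g a <> r) ->
  tHD_eq_0 X.
Proof.
  intros [x0 _] Hmiss. pose proof (lipschitz_image_ind_le_0 X Hmiss) as H.
  split; [exact H|].
  exists (fun _ => True), X, (@proj1_sig _ _).
  assert (HL : lipschitz_on (fun _ : X => True) (@proj1_sig _ _)).
  { exists 1. split; [lra|]. intros a b. lra. }
  split; [exact HL|]. split; [now apply H|].
  intro Hno. apply (Hno x0). now exists (exist _ x0 Logic.I).
Qed.

(** * The two cases *)

Lemma dyadic_gauge : gauge (fun n => / 2 ^ n).
Proof.
  assert (Hp : forall n, 0 < 2 ^ n) by (intro; apply pow_lt; lra).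
  refine (conj _ (conj _ (conj _ _))).
  - intro n. now apply Rinv_0_lt_compat.
  - intro n. apply Rinv_le_contravar; [apply Hp|]. cbn. specialize (Hp n). lra.
  - cbn. lra.
  - intros eps Heps. destruct (pow_lt_1_zero (/ 2)) with (y := eps) as [N HN];
      [rewrite Rabs_pos_eq; lra | assumption |].
    exists N. specialize (HN N (Nat.le_refl N)). rewrite <- pow_inv.
    rewrite Rabs_pos_eq in HN; [exact HN | apply pow_le; lra].
Qed.

(* Branches are compared by node numbers, so points first differing at index [n]
   share their ancestor of level [n - 1]; the root is always shared. *)
Definition fact_gauge (n : nat) : R := / INR (fact (n - 1)).

Lemma fact_gauge_gauge : gauge fact_gauge.
Proof.
  unfold fact_gauge. refine (conj _ (conj _ (conj _ _))).
  - intro n. apply Rinv_0_lt_compat, INR_fact_pos.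
  - intro n. apply Rinv_le_contravar; [apply INR_fact_pos|]. apply le_INR, fact_le. lia.
  - cbn. lra.
  - intros eps Heps. destruct (archimed_cor1 eps Heps) as [N [HN HN0]].
    exists (S N). refine (Rle_lt_trans _ _ _ _ HN). cbn. rewrite Nat.sub_0_r.
    apply Rinv_le_contravar; [now apply lt_0_INR|]. apply le_INR.
    clear. induction N as [|N IH]; [lia|]. rewrite fact_simpl.
    pose proof (lt_O_fact N). nia.
Qed.

Lemma fact_gauge_pow p n : fact_gauge n ^ p = / INR (width p (n - 1)).
Proof. unfold fact_gauge, width. now rewrite pow_inv, pow_INR. Qed.

Lemma cyl_cover_nonempty rho p eps X : gauge rho -> (1 <= p)%nat -> 0 < eps ->
  ~ cyl_cover rho p eps X -> exists x, X x.
Proof.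
  intros Hg Hp Heps Hno. apply NNPP. intro He. apply Hno.
  destruct (functional_choice (fun k n => (1 <= n)%nat /\ rho n ^ p <= (/ 2) ^ S k * eps))
    as [n Hn].
  { intro k. apply small_pow; auto. apply Rmult_lt_0_compat; [apply pow_lt|]; lra. }
  exists (fun _ _ => O), n. refine (conj _ (conj _ _)).
  - intro k. apply Hn.
  - intro K. apply Rle_trans with (sum_f_R0 (fun k => (/ 2) ^ S k * eps) K).
    + apply sum_Rle. intros k _. apply Hn.
    + rewrite <- scal_sum, sum_half_pow.
      assert (0 < (/ 2) ^ S K) by (apply pow_lt; lra). nra.
  - intros x Hx. exfalso. eauto.
Qed.

Lemma uspace_witness rho (Hg : gauge rho) X p s eps :
  (1 <= p)%nat -> s <= INR p -> 0 < eps -> ~ cyl_cover rho p eps X ->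
  (forall (Y : uspace rho Hg X -> Prop) (g : {x | Y x} -> R) L, 0 <= L ->
     (forall a b, Rabs (g a - g b) <= L * dist (proj1_sig a) (proj1_sig b)) ->
     exists r, 0 <= r <= 1 /\ forall a, g a <> r) ->
  exists X : MetricSpace, separable X /\ tHD_eq_0 X /\ dimH_ge X s.
Proof.
  intros Hp Hs Heps Hno Hmiss.
  destruct (cyl_cover_nonempty rho p eps X Hg Hp Heps Hno) as [x0 Hx0].
  exists (uspace rho Hg X). refine (conj _ (conj _ _)).
  - apply uspace_separable. eauto.
  - apply tHD_eq_0_of_missing_values; [|exact Hmiss]. now exists (exist _ x0 Hx0).
  - intros t Ht Hnull. destruct (Rle_lt_dec s t) as [|Hlt]; [assumption|].
    exfalso. apply Hno. apply (null_cyl_cover rho Hg X p t); auto. lra.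
Qed.

(** The empty relation is consistent, so the Cantor scheme applies and its values are pairwise
    distinct. *)
Lemma unit_interval_large : exists rr : (nat -> bool) -> R,
  (forall e, 0 <= rr e <= 1) /\ forall e e', rr e = rr e' -> e = e'.
Proof.
  destruct (thin_values 0 (fun _ _ _ => False) 0) as (_ & rr & _ & _ & _ & _ & H01 & _ & Hinj).
  - split; tauto.
  - eauto.
Qed.

Lemma segment_misses_value (I : Type) (lt : I -> I -> Prop) a (g : I -> R) :
  (forall a (f : I -> nat -> bool), exists e, forall b, lt b a -> f b <> e) ->
  exists r, 0 <= r <= 1 /\ forall b, lt b a -> g b <> r.
Proof.
  intro Hsm. destruct unit_interval_large as [rr [H01 Hinj]].
  destruct (Hsm a (fun b => epsilon (inhabits (fun _ => true)) (fun e => g b = rr e)))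
    as [e He].
  exists (rr e). split; [apply H01|]. intros b Hb E. apply (He b Hb). apply Hinj.
  rewrite <- E. symmetry. apply epsilon_spec. eauto.
Qed.

Lemma window_parent r n q : in_window r (S n) q -> in_window r n (q / S n).
Proof.
  unfold in_window. rewrite fact_simpl, mult_INR. intros [H1 H2].
  pose proof (Nat.div_mod_eq q (S n)) as E.
  pose proof (Nat.mod_upper_bound q (S n) ltac:(lia)) as Hlt.
  set (a := (q / S n)%nat) in *. set (b := (q mod S n)%nat) in *.
  apply (f_equal INR) in E. rewrite plus_INR, mult_INR in E.
  pose proof (pos_INR b) as Hb. apply le_INR in Hlt. rewrite S_INR in Hlt.
  pose proof (lt_0_INR (S n) ltac:(lia)) as HB.
  split; apply (Rmult_le_reg_l (INR (S n))); nra.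
Qed.

Lemma lipschitz_consistent p X (HX : forall x, X x -> branch p x)
    (Y : uspace fact_gauge fact_gauge_gauge X -> Prop) (g : {x | Y x} -> R) L :
  0 <= L ->
  (forall a b, Rabs (g a - g b) <= L * dist (proj1_sig a) (proj1_sig b)) ->
  exists W, consistent p (fun n v q => exists a : {x | Y x},
    proj1_sig (proj1_sig a) n = v /\ in_window (g a) n q) W.
Proof.
  intros HL Hg. destruct (INR_unbounded (L + 1)) as [W HW]. exists W. split.
  - intros n v q q' [a [Ea [Ha _]]] [b [Eb [_ Hb]]].
    assert (Hd : dist (proj1_sig a) (proj1_sig b) <= / INR (fact n)).
    (* A common node of level [n] forces agreement at all indices up to [n], and [fact_gauge (S n)]
       is 1/n!. *)
    { replace n with (S n - 1)%nat by lia. apply (udist_agree fact_gauge).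
      - apply fact_gauge_gauge.
      - intros i Hi. apply (branch_agree p _ _ n); [| | congruence | lia];
          apply HX, proj2_sig. }
    pose proof (INR_fact_pos n) as Hf. specialize (Hg a b).
    assert (Hab : g a - g b <= L * / INR (fact n)).
    { apply Rle_trans with (Rabs (g a - g b)); [apply Rle_abs|].
      apply Rle_trans with (1 := Hg). now apply Rmult_le_compat_l. }
    apply (Rmult_le_compat_r (INR (fact n))) in Hab; [|lra].
    rewrite Rmult_assoc, Rinv_l in Hab by lra.
    apply INR_le. rewrite plus_INR. lra.
  - intros n v q [a [Ea Ha]]. exists a. split; [|now apply window_parent].
    rewrite <- Ea. symmetry. apply (HX _ (proj2_sig (proj1_sig a))).
Qed.

(** All branches in a cylinder of length [n k] share their node of level [n k - 1], and one node has
    mass [fact_gauge (n k) ^ p]; a cylinder cover would thus be a cover of mass at most 1/2. *)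
Lemma not_cyl_cover_fact p X : (forall x, X x -> branch p x) ->
  (forall h, (forall K, sum_f_R0 (fun k => mass p (h k)) K <= 1 / 2) ->
     exists x, X x /\ forall k, ~ hits x (h k)) ->
  ~ cyl_cover fact_gauge p (1 / 2) X.
Proof.
  intros HX Hpos [z [n [Hn [Hsum Hcov]]]].
  destruct (functional_choice (fun k a => clevel a = (n k - 1)%nat /\
    forall v, (v < width p (n k - 1))%nat -> cset a v <-> v = z k (n k - 1)%nat)) as [h Hh].
  { intro k. apply code_exists. }
  destruct (Hpos h) as [x [Hx Hav]].
  - intro K. refine (Rle_trans _ _ _ _ (Hsum K)). apply sum_Rle. intros k _.
    rewrite fact_gauge_pow. destruct (Hh k) as [Hl Hs]. unfold mass.
    rewrite Hl, (cnt_ext _ _ _ Hs). pose proof (INR_width_pos p (n k - 1)).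
    rewrite <- (Rmult_1_l (/ _)).
    apply Rmult_le_compat_r; [left; now apply Rinv_0_lt_compat|].
    apply (le_INR _ 1). apply (cnt_spread _ 0). intros; subst; lia.
  - destruct (Hcov x Hx) as [k Hk]. apply (Hav k). unfold hits.
    destruct (Hh k) as [Hl Hs]. rewrite Hl. apply Hs; [now apply branch_lt, HX|].
    apply Hk. specialize (Hn k). lia.
Qed.

Theorem theorem4p7 : forall s : R, 0 < s ->
  exists X : MetricSpace, separable X /\ tHD_eq_0 X /\ dimH_ge X s.
Proof.
  intros s Hs. destruct (INR_unbounded s) as [p Hp].
  assert (Hp1 : (1 <= p)%nat).
  { destruct p; [cbn in Hp; lra | lia]. }
  destruct continuum_well_order as (I & lt & enum & wf & tri & Hen & Hsm).
  destruct (classic (forall a (zf : I -> nat -> nat),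
     cyl_cover (fun n => / 2 ^ n) p (1 / 4) (fun x => exists b, lt b a /\ x = zf b)))
    as [Hcov|Hno].
  - destruct (positive_set_missing_values p I lt enum wf tri Hen Hsm Hcov)
      as (X & HX & Hpos & Hmiss).
    apply (uspace_witness fact_gauge fact_gauge_gauge X p s (1 / 2)); auto; try lra.
    + now apply not_cyl_cover_fact.
    + intros Y g L HL Hg.
      destruct (lipschitz_consistent p X HX Y g L HL Hg) as [W HW].
      destruct (Hmiss _ W HW) as [r [Hr Hne]]. exists r. split; [exact Hr|].
      intros a E. apply (Hne _ (proj2_sig (proj1_sig a))).
      intros n q Hq. exists a. now rewrite E.
  - apply not_all_ex_not in Hno. destruct Hno as [a Hno].
    apply not_all_ex_not in Hno. destruct Hno as [zf Hno].
    apply (uspace_witness _ dyadic_gauge _ p s (1 / 4) Hp1 ltac:(lra) ltac:(lra) Hno).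
    intros Y g L _ _.
    (* [val b] is the value of [g] at [zf b], and arbitrary if [zf b] is outside [Y]; thus [g]
       becomes a function on the segment below [a]. *)
    set (val := fun b => epsilon (inhabits 0) (fun r =>
      exists c : {x | Y x}, proj1_sig (proj1_sig c) = zf b /\ r = g c)).
    destruct (segment_misses_value I lt a val Hsm) as [r [Hr Hne]].
    exists r. split; [exact Hr|]. intros c E.
    destruct (proj2_sig (proj1_sig c)) as [b [Hb Ec]].
    apply (Hne b Hb).
    assert (Hv : exists c' : {x | Y x}, proj1_sig (proj1_sig c') = zf b /\ val b = g c').
    { unfold val. apply (epsilon_spec (inhabits 0) (fun r =>
        exists c : {x | Y x}, proj1_sig (proj1_sig c) = zf b /\ r = g c)). eauto. }
    destruct Hv as [c' [Ec' ->]]. rewrite <- E. f_equal.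
    apply eq_sig_hprop; [intros; apply proof_irrelevance|].
    apply eq_sig_hprop; [intros; apply proof_irrelevance|]. congruence.
Qed.
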